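(* Let $n\ge2$. The map $T_3$ (which sends a factorisation to the associated unlabeled plane tree) is a bijection between the set $\mathcal F_n^{\downarrow}$ of decreasing factorisations of size $n$ and the set $\Pi_n$ of plane trees with $n$ vertices.
   Context: A minimal factorisation of size $n\ge2$ is a tuple $(\tau_1,\dots,\tau_{n-1})$ of transpositions of $\{1,\dots,n\}$ with $\tau_{n-1}\circ\dots\circ\tau_1=(1\ 2\ \dots\ n)$ ($\tau_1$ applied first). Writing $\tau_i=(a_i\ b_i)$ with $a_i<b_i$, it is decreasing if $a_1\ge a_2\ge\dots\ge a_{n-1}$; $\mathcal F_n^{\downarrow}$ is the set of decreasing factorisations of size $n$. A plane tree is a rooted tree where, for every vertex $v$, a total order is given on the edges stemming from $v$ (the edges going from $v$ to its children); plane trees are considered up to isomorphism preserving root and orders. $\Pi_n$ is the set of plane trees with $n$ vertices. For a minimal factorisation $f=(\tau_1,\dots,\tau_{n-1})$ of size $n$, consider the graph with vertices labeled $1,\dots,n$ and, for each $k\in\{1,\dots,n-1\}$, an edge labeled $k$ between the vertices labeled $i$ and $j$ where $\tau_k=(i\ j)$. This graph is a tree. $T_1(f)$ is this labeled tree, rooted at the vertex labeled $1$ and made into a plane tree by ordering the edges stemming from each vertex by increasing edge label. $T_3(f)\in\Pi_n$ is the plane tree obtained from $T_1(f)$ by forgetting all vertex labels and edge labels (keeping the shape, root and plane order). *)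

(* Defs.v *)
From mathcomp Require Import all_boot all_fingroup.
From mathcomp Require Export classical_sets functions.

Set Implicit Arguments.
Unset Strict Implicit.
Unset Printing Implicit Defensive.

Local Open Scope classical_set_scope.

(* The labels 1, ..., n are represented by the ordinals 0, ..., n - 1 of 'I_n,
   and the indices 1, ..., n - 1 by the ordinals 0, ..., n - 2 of 'I_n.-1. *)

Definition transposition n (s : {perm 'I_n}) : Prop :=
  exists a b : 'I_n, a != b /\ s = tperm a b.

Definition long_cycle n : {perm 'I_n} := perm (@ordS_inj n).

(* In {perm T} the left factor of a product acts first: (s * t) x = t (s x),
   so the product below is tau_{n-1} o ... o tau_1. *)
Definition minimal_factorisation n (f : n.-1.-tuple {perm 'I_n}) : Prop :=
  (forall k, transposition (tnth f k)) /\
  (\prod_(k < n.-1) tnth f k)%g = long_cycle n.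

Definition decreasing n (f : n.-1.-tuple {perm 'I_n}) : Prop :=
  exists a b : 'I_n.-1 -> 'I_n,
    (forall k, (a k < b k)%N /\ tnth f k = tperm (a k) (b k)) /\
    (forall k l : 'I_n.-1, (k <= l)%N -> (a l <= a k)%N).

Definition decreasing_factorisations n : set (n.-1.-tuple {perm 'I_n}) :=
  [set f | minimal_factorisation f /\ decreasing f].

(* A vertex is given with the list, in the plane order, of the subtrees
   of its children. An isomorphism class of plane trees is thus exactly one
   term, and isomorphism is equality. *)
Inductive plane_tree : Type := PNode of seq plane_tree.

Fixpoint nb_vertices (t : plane_tree) : nat :=
  let: PNode ts := t in (sumn [seq nb_vertices s | s <- ts]).+1.

Definition plane_trees (n : nat) : set plane_tree :=
  [set t | nb_vertices t = n].

(* Plane trees with vertex labels in V and edge labels in E: a vertex comes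
   with the list, in the plane order, of its outgoing edges, each one paired
   with the subtree of the child it leads to. *)
Inductive labeled_plane_tree (V E : Type) : Type :=
  LNode of V & seq (E * labeled_plane_tree V E).

Fixpoint forget_labels V E (t : labeled_plane_tree V E) : plane_tree :=
  let: LNode _ es := t in PNode [seq forget_labels e.2 | e <- es].

(* The labels of the edges of the graph of f incident to v, increasingly.
   When tnth f k is a transposition, it moves v iff v is an endpoint of the
   edge labeled k, and the other endpoint is then tnth f k v. *)
Definition incident_edges n (f : n.-1.-tuple {perm 'I_n}) (v : 'I_n) :
    seq 'I_n.-1 :=
  [seq k <- enum 'I_n.-1 | tnth f k v != v].

(* The part of the tree below v, cut at height h, where p is the label of the
   edge from v to its parent (None at the root): the edges stemming from v are
   all the edges incident to v except p. *)
Fixpoint subtree_below n (f : n.-1.-tuple {perm 'I_n})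
    (h : nat) (v : 'I_n) (p : option 'I_n.-1) :
    labeled_plane_tree 'I_n 'I_n.-1 :=
  if h is h'.+1 then
    LNode v [seq (k, subtree_below f h' (tnth f k v) (Some k))
            | k <- incident_edges f v & Some k != p]
  else LNode v [::].

(* The graph of a minimal factorisation is a tree with n vertices, so its
   height is less than n and cutting at height n removes nothing. *)
Definition T1 n (hn : 1 < n) (f : n.-1.-tuple {perm 'I_n}) :
    labeled_plane_tree 'I_n 'I_n.-1 :=
  subtree_below f n (Ordinal (ltnW hn)) None.

Definition T3 n (hn : 1 < n) (f : n.-1.-tuple {perm 'I_n}) : plane_tree :=
  forget_labels (T1 hn f).

(* Main.v *)
Require Import Defs.
From mathcomp Require Import all_boot all_fingroup.
From mathcomp Require Import classical_sets functions.
From mathcomp Require Import zify.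

(* Grafting [u] as the last child of the root of [t] generates all plane trees
   from the single vertex. Number the vertices of a plane tree in preorder. The
   factorisation attached to the graft is that of [u], followed by that of [t],
   followed by the transposition of the roots of [t] and [u]: this last factor
   merges the cycles on the two consecutive intervals labelling [t] and [u], and
   the smaller endpoints are decreasing.
   Conversely, peel the factors of a decreasing factorisation off from the last
   one. Each of the n - 1 factors must split a cycle of what remains, since a
   product of k transpositions has at least n - k cycles. By decrease, the
   smaller endpoint of the peeled factor is the least label still moved, so what
   remains always permutes consecutive intervals cyclically, and the factor
   undoes a grafting. *)

Set Implicit Arguments.
Unset Strict Implicit.
Unset Printing Implicit Defensive.

(** * Grafting and the preorder edge list *)

Definition graft (t u : plane_tree) : plane_tree :=
  let: PNode ts := t in PNode (rcons ts u).

Lemma nb_vertices_gt0 t : 0 < nb_vertices t.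
Proof. by case: t. Qed.

Lemma nb_vertices_graft t u :
  nb_vertices (graft t u) = nb_vertices t + nb_vertices u.
Proof. by case: t => ts /=; rewrite map_rcons sumn_rcons addSn. Qed.

Lemma graft_ind (P : plane_tree -> Prop) :
  P (PNode [::]) -> (forall t u, P t -> P u -> P (graft t u)) -> forall t, P t.
Proof.
move=> P0 PS t; have [N] := ubnP (nb_vertices t); elim: N t => // N IHN [ts].
case/lastP: ts => // ts u; rewrite -[PNode _]/(graft (PNode ts) u) => leN.
have := nb_vertices_gt0 u; have := nb_vertices_gt0 (PNode ts).
rewrite nb_vertices_graft in leN => ? ?; apply: PS; apply: IHN; lia.
Qed.

(* Parent-child pairs of [t] when its vertices are numbered in preorder from
   [o]; the accumulator holds the next free number and the pairs found so far. *)
Fixpoint preorder_edges (t : plane_tree) (o : nat) : seq (nat * nat) :=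
  let: PNode ts := t in
  (foldl (fun bE u => (bE.1 + nb_vertices u,
                       preorder_edges u bE.1 ++ rcons bE.2 (o, bE.1)))
         (o.+1, [::]) ts).2.

Lemma preorder_edges_graft t u o :
  preorder_edges (graft t u) o =
  preorder_edges u (o + nb_vertices t) ++
    rcons (preorder_edges t o) (o, o + nb_vertices t).
Proof.
case: t => ts /=; rewrite foldl_rcons /=.
set F := foldl _ _ ts.
suff -> : F.1 = o + (sumn [seq nb_vertices s | s <- ts]).+1 by [].
rewrite {}/F; elim/last_ind: ts => [|ts s IHs] /=; first by rewrite addn1.
by rewrite foldl_rcons /= IHs map_rcons sumn_rcons -addnA addSn.
Qed.

Lemma size_preorder_edges t o : (size (preorder_edges t o)).+1 = nb_vertices t.
Proof.
elim/graft_ind: t o => // t u IHt IHu o.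
have := IHt o; have := IHu (o + nb_vertices t).
by rewrite preorder_edges_graft nb_vertices_graft size_cat size_rcons; lia.
Qed.

Lemma preorder_edges_range t o e : e \in preorder_edges t o ->
  o <= e.1 < e.2 /\ e.2 < o + nb_vertices t.
Proof.
elim/graft_ind: t o => // t u IHt IHu o.
have := nb_vertices_gt0 u; have := nb_vertices_gt0 t.
rewrite preorder_edges_graft nb_vertices_graft mem_cat mem_rcons inE.
by move=> ? ? /or3P[/IHu|/eqP-> /=|/IHt]; lia.
Qed.

Lemma preorder_edges_target t o x :
  x \in [seq e.2 | e <- preorder_edges t o] -> o < x < o + nb_vertices t.
Proof. by case/mapP => -[a b] /preorder_edges_range /= he ->; lia. Qed.

(** A vertex has at most one parent; this later singles out the edge to the parent among the
    incident edges. *)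
Lemma preorder_edges_uniq t o : uniq [seq e.2 | e <- preorder_edges t o].
Proof.
elim/graft_ind: t o => // t u IHt IHu o.
have := nb_vertices_gt0 u; have := nb_vertices_gt0 t => ? ?.
rewrite preorder_edges_graft map_cat cat_uniq IHu map_rcons rcons_uniq IHt.
rewrite andbT /=.
apply/andP; split; last by apply/negP => /preorder_edges_target; lia.
apply/hasPn => x; rewrite mem_rcons inE => /orP[/eqP-> /=|/preorder_edges_target he].
  by apply/negP => /preorder_edges_target; lia.
by apply/negP => /preorder_edges_target; lia.
Qed.

Definition decreasing_edges (E : seq (nat * nat)) :=
  pairwise (fun e e' => e'.1 <= e.1) E.

(** Sources in [u] lie beyond the interval of [t], and the last pair starts at [o], the least label,
    so grafting preserves the decrease. *)
Lemma preorder_edges_decreasing t o : decreasing_edges (preorder_edges t o).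
Proof.
elim/graft_ind: t o => // t u IHt IHu o.
rewrite /decreasing_edges preorder_edges_graft pairwise_cat pairwise_rcons.
rewrite -!/(decreasing_edges _) IHt IHu !andbT; apply/andP; split.
  apply/allrelP => -[a b] [c d] /preorder_edges_range /= he.
  by rewrite mem_rcons inE /= => /orP[/eqP[-> _]|/preorder_edges_range /=]; lia.
by apply/allP => -[a b] /preorder_edges_range /=; lia.
Qed.

(** * Recovering a tree from its edge list *)

Fixpoint tree_above (E : seq (nat * nat)) (h v : nat) : plane_tree :=
  if h is h'.+1 then
    PNode [seq tree_above E h' e.2 | e <- E & e.1 == v]
  else PNode [::].

(** Only vertices reachable from [v] matter, and they stay in the closed set [R]. This isolates
    either component of a graft. *)
Lemma eq_tree_above (E E' : seq (nat * nat)) (R : pred nat) h v :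
  (forall w, R w -> [seq e <- E | e.1 == w] = [seq e <- E' | e.1 == w]) ->
  (forall e, e \in E' -> R e.1 -> R e.2) ->
  R v -> tree_above E h v = tree_above E' h v.
Proof.
move=> eqE clR; elim: h v => //= h IHh v Rv; rewrite eqE //; congr PNode.
apply/eq_in_map => e; rewrite mem_filter => /andP[/eqP ev eE].
by apply: IHh; apply: clR => //; rewrite ev.
Qed.

Lemma tree_above_preorder_edges t o h :
  nb_vertices t <= h -> tree_above (preorder_edges t o) h o = t.
Proof.
elim/graft_ind: t o h => [|t u IHt IHu] o h; first by case: h.
have := nb_vertices_gt0 u; have := nb_vertices_gt0 t => ? ?.
case: h => [|h]; rewrite nb_vertices_graft => leh; first by lia.
set E := preorder_edges _ _.
have EE := preorder_edges_graft t u o; rewrite -/E in EE.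
have filt_u w : w < o + nb_vertices t ->
    [seq e <- preorder_edges u (o + nb_vertices t) | e.1 == w] = [::].
  move=> hw; apply/eqP; rewrite -size_eq0 size_filter -leqn0 leqNgt -has_count.
  by apply/hasPn => -[a b] /preorder_edges_range /=; lia.
have -> : tree_above E h.+1 o =
    PNode (rcons [seq tree_above E h e.2 | e <- preorder_edges t o & e.1 == o]
                 (tree_above E h (o + nb_vertices t))).
  rewrite /= {2}EE filter_cat filt_u ?filter_rcons ?eqxx ?map_rcons //=; lia.
have -> : tree_above E h (o + nb_vertices t) = u.
  rewrite -[RHS](IHu (o + nb_vertices t) h); last by lia.
  apply: (@eq_tree_above _ _ (fun w => o + nb_vertices t <= w)) => //.
    move=> w hw; rewrite EE filter_cat filter_rcons /= ifF; last by lia.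
    rewrite -[RHS]cats0; congr cat; apply/eqP.
    rewrite -size_eq0 size_filter -leqn0 leqNgt -has_count.
    by apply/hasPn => -[a b] /preorder_edges_range /=; lia.
  by move=> [a b] /preorder_edges_range /=; lia.
have <- : graft (tree_above (preorder_edges t o) h.+1 o) u = graft t u.
  by rewrite IHt //; lia.
congr (PNode (rcons _ _)); apply/eq_in_map => -[a b] /=.
rewrite mem_filter => /andP[_ eE].
(* The root [o] is left out of the range: grafting gives it one more outgoing pair, while the other
   vertices of [t] keep theirs. *)
apply: (@eq_tree_above _ _ (fun w => o < w < o + nb_vertices t)).
- move=> w hw; rewrite EE filter_cat filter_rcons filt_u /= ?ifF //; lia.
- by move=> [c d] /preorder_edges_range /=; lia.
- by have := preorder_edges_range eE => /=; lia.
Qed.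

(** * Edges as transpositions, and the tree that [T3] reads from them *)

Definition factor_perm n (e : nat * nat) : {perm 'I_n.+1} :=
  tperm (inord e.1) (inord e.2).

(** Keeps labels in the range where [inord] is faithful; beyond [n] it returns [0]. *)
Definition edges_in n (E : seq (nat * nat)) :=
  all (fun e => e.1 < e.2 <= n) E.

Lemma val_factor_perm n (e : nat * nat) (x : 'I_n.+1) : e.1 < e.2 <= n ->
  factor_perm n e x =
  (if x == e.1 :> nat then e.2 else if x == e.2 :> nat then e.1 else x) :> nat.
Proof.
move=> he; rewrite /factor_perm permE /= -!val_eqE /= !inordK; try lia.
by case: ifP => _; [rewrite inordK //; lia|case: ifP => _ //; rewrite inordK //; lia].
Qed.

Section T3_of_edges.
Variables (n : nat) (f : n.-tuple {perm 'I_n.+1}) (E : seq (nat * nat)).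
Hypotheses (fE : f = [seq factor_perm n e | e <- E] :> seq _)
  (inE : edges_in n E) (uE : uniq [seq e.2 | e <- E]).

Let e0 : nat * nat := (0, 0).

Let sizeE : size E = n.
Proof. by rewrite -(size_map (factor_perm n) E) -fE size_tuple. Qed.

Let nthE (k : 'I_n) : (nth e0 E k).1 < (nth e0 E k).2 <= n.
Proof. by apply: (allP inE); rewrite mem_nth ?sizeE. Qed.

Let tnthE (k : 'I_n) : tnth f k = factor_perm n (nth e0 E k).
Proof. by rewrite (tnth_nth 1%g) fE (nth_map e0) ?sizeE. Qed.

Let mapE : [seq nth e0 E (val k) | k <- enum 'I_n] = E.
Proof.
by rewrite (map_comp (nth e0 E)) val_enum_ord -sizeE -/(mkseq _ _) mkseq_nth.
Qed.

(** The hypothesis says that [p] is the one edge entering [v], or that none does. Discarding [p]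
    from the incident edges then leaves those with source [v], in list order, which is what
    [tree_above] selects. *)
Lemma forget_subtree_below h (v : 'I_n.+1) (p : option 'I_n) :
  (forall k : 'I_n, (Some k == p) = ((nth e0 E k).2 == v)) ->
  forget_labels (@subtree_below n.+1 f h v p) = tree_above E h v.
Proof.
elim: h v p => //= h IHh v p hp; congr PNode.
rewrite -[X in _ = [seq _ | _ <- filter _ X]]mapE filter_map -!map_comp.
rewrite /incident_edges -filter_predI.
rewrite (@eq_filter _ _ (fun k : 'I_n => (nth e0 E k).1 == v)); last first.
  move=> k /=; rewrite hp -val_eqE /= tnthE val_factor_perm //.
  by have := nthE k; case: ifP => [|?]; [|case: ifP]; lia.
apply/eq_in_map => k; rewrite mem_filter => /andP[/eqP kv _] /=.
have fkv : tnth f k v = (nth e0 E k).2 :> nat.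
  by rewrite tnthE val_factor_perm // kv eqxx.
(* Targets being distinct, [k] is the only edge entering the child. *)
rewrite -fkv; apply: IHh => l; rewrite fkv -!(nth_map _ 0 snd) ?sizeE //.
by rewrite nth_uniq ?size_map ?sizeE.
Qed.

End T3_of_edges.

(** * The product of the factors attached to a tree *)

Definition edges_perm n (E : seq (nat * nat)) : {perm 'I_n.+1} :=
  (\prod_(e <- E) factor_perm n e)%g.

Lemma edges_perm_rcons n E e :
  edges_perm n (rcons E e) = (edges_perm n E * factor_perm n e)%g.
Proof. by rewrite /edges_perm big_rcons. Qed.

(** The cycle [(o o+1 ... o+m-1)], extended by the identity to all naturals. *)
Definition cycle_step (o m x : nat) : nat :=
  if o <= x < o + m then if x.+1 == o + m then o else x.+1 else x.

Lemma edges_perm_preorder n t o (x : 'I_n.+1) : o + nb_vertices t <= n.+1 ->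
  edges_perm n (preorder_edges t o) x = cycle_step o (nb_vertices t) x :> nat.
Proof.
elim/graft_ind: t o x => [|t u IHt IHu] o x.
  by rewrite /edges_perm big_nil perm1 /cycle_step /=; repeat case: ifP; lia.
have := nb_vertices_gt0 u; have := nb_vertices_gt0 t => ? ?.
rewrite preorder_edges_graft nb_vertices_graft => le_n.
rewrite /edges_perm big_cat big_rcons /= !permM -!/(edges_perm _ _).
rewrite val_factor_perm /=; last by lia.
rewrite IHt ?IHu; [|lia|lia]; rewrite /cycle_step.
by repeat case: ifP; lia.
Qed.

Lemma preorder_edges_in n t o : o + nb_vertices t <= n.+1 ->
  edges_in n (preorder_edges t o).
Proof. by move=> le_n; apply/allP => -[a b] /preorder_edges_range /=; lia. Qed.

(** The product of the cycles on consecutive intervals of lengths [ms], the first one starting at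
    [o]. *)
Fixpoint intervals_step (o : nat) (ms : seq nat) (x : nat) : nat :=
  if ms is m :: ms' then
    if x < o + m then cycle_step o m x else intervals_step (o + m) ms' x
  else x.

Lemma intervals_step_ge o ms x : o <= x -> o <= intervals_step o ms x.
Proof.
elim: ms o => //= m ms IHms o ox; rewrite /cycle_step.
case: (ltnP x (o + m)) => xm; first by repeat case: ifP; lia.
by apply: leq_trans (IHms _ xm); lia.
Qed.

Lemma intervals_step_lt o ms x : x < o -> intervals_step o ms x = x.
Proof.
elim: ms o => //= m ms IHms o ox; rewrite /cycle_step.
by rewrite IHms; [repeat case: ifP; lia|lia].
Qed.

(** * Counting cycles, and peeling decreasing edge lists *)

Definition nb_cycles (T : finType) (s : {perm T}) : nat := #|porbits s|.

Lemma nb_cycles1 (T : finType) : nb_cycles (1%g : {perm T}) = #|T|.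
Proof.
rewrite /nb_cycles card_imset // => x y /eqP; rewrite eq_porbit_mem => /porbitP[i ->].
by rewrite expg1n perm1.
Qed.

Lemma nb_cycles_mul_factor n (s : {perm 'I_n.+1}) e : e.1 < e.2 <= n ->
  nb_cycles (s * factor_perm n e)%g +
    (inord e.2 \notin porbit s (inord e.1)).*2 = nb_cycles s + 1.
Proof.
(* [porbits_mul_tperm] multiplies on the left; passing to inverses, which have the same orbits,
   moves the factor to the right. *)
move=> he; have := porbits_mul_tperm s^-1 (inord e.1) (inord e.2).
rewrite /= porbitsV porbitV porbit_sym -val_eqE /= !inordK; [|lia|lia].
rewrite -[porbits (_ * _)]porbitsV invMg tpermV invgK /nb_cycles => ->.
by case: eqP he => // ->; rewrite ltnn.
Qed.

(** The identity has [n.+1] cycles, and each factor lowers the count by at most one. *)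
Lemma leq_nb_cycles_edges n E : edges_in n E ->
  n < nb_cycles (edges_perm n E) + size E.
Proof.
elim/last_ind: E => [_|E e IHE].
  by rewrite /edges_perm big_nil nb_cycles1 card_ord addn0.
rewrite /edges_in all_rcons => /andP[he /IHE hE].
have := nb_cycles_mul_factor (edges_perm n E) he.
by rewrite edges_perm_rcons size_rcons; case: (_ \notin _) => /=; lia.
Qed.

(** Later trees carry larger labels, so their edges come first to keep sources decreasing. *)
Fixpoint forest_edges (ts : seq plane_tree) (o : nat) : seq (nat * nat) :=
  if ts is t :: ts' then
    forest_edges ts' (o + nb_vertices t) ++ preorder_edges t o
  else [::].

Lemma porbit_closed (T : finType) (s : {perm T}) (A : pred T) x y :
  (forall z, A z -> A (s z)) -> A x -> y \in porbit s x -> A y.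
Proof.
move=> sA Ax /porbitP[i ->]; elim: i => [|i]; first by rewrite expg0 perm1.
by rewrite expgSr permM; apply: sA.
Qed.

(** The bound on [nb_cycles] is the reverse of [leq_nb_cycles_edges], so it expresses minimality.
    Each induction step either drops the fixed label [o] or peels off the last edge, hence the
    measure [size E + sumn ms]. *)
Lemma decreasing_edges_forest n E o ms :
  edges_in n E -> decreasing_edges E -> all (fun e => o <= e.1) E ->
  all (leq 1) ms -> o + sumn ms = n.+1 ->
  nb_cycles (edges_perm n E) + size E <= n.+1 ->
  (forall x : 'I_n.+1, edges_perm n E x = intervals_step o ms x :> nat) ->
  exists ts, [seq nb_vertices t | t <- ts] = ms /\ E = forest_edges ts o.
Proof.
have [N] := ubnP (size E + sumn ms).
elim: N E o ms => // N IHN E o ms leN E_in decE leE ms_gt0 sum_ms cardE permE.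
have [gtE|] := boolP (all (fun e => o < e.1) E).
  case: ms => [|m ms] in leN ms_gt0 sum_ms permE *.
    case: E => [|[a b] E] in E_in gtE {leN decE leE cardE permE} *; first by exists [::].
    by move: E_in gtE sum_ms => /= /andP[/= + _] /andP[/= + _]; lia.
  move: ms_gt0 sum_ms leN => /= /andP[m_gt0 ms_gt0] sum_ms leN.
  have oE : edges_perm n E (inord o) = inord o.
    rewrite /edges_perm; elim: (E) E_in gtE => [|[a b] F IHF] /=.
      by rewrite big_nil perm1.
    move=> /andP[/= ab F_in] /andP[/= oa gtF].
    rewrite big_cons permM -[RHS]IHF //; congr (_ _); apply: val_inj.
    rewrite /= val_factor_perm /= ?inordK; [|lia|lia].
    by repeat case: ifP; lia.
  (* A cycle of length at least two starting at [o] would move [o]. *)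
  have m1 : m = 1.
    have := permE (inord o); rewrite oE inordK; last by lia.
    by rewrite /= /cycle_step; repeat case: ifP; lia.
  rewrite {}m1 {m_gt0} in sum_ms leN permE *.
  have [||||||| x|ts [<- ->]] // := IHN E o.+1 ms; [lia|lia| |].
    rewrite permE /=; case: ltnP; rewrite addn1 // => xo.
    by rewrite intervals_step_lt // /cycle_step; repeat case: ifP; lia.
  by exists (PNode [::] :: ts); rewrite /= cats0 addn1.
case/lastP: E => // E [a b] in leN E_in decE leE cardE permE * => ngtE.
move: leE; rewrite all_rcons /= => /andP[oa leE].
move: decE; rewrite /decreasing_edges pairwise_rcons => /andP[/allP geE decE].
move: E_in; rewrite /edges_in all_rcons /= => /andP[ab E_in].
(* Some source is at most [o], and by decrease the last one is the least. *)
have ao : a = o.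
  move: ngtE; rewrite all_rcons /= negb_and -leqNgt => /orP[|/allPn[[c d] cE /=]].
    by move: oa; lia.
  by have /= := geE _ cE; lia.
rewrite {}ao {oa} in ab cardE permE geE ngtE leN *.
have ltE := leq_nb_cycles_edges E_in.
have := nb_cycles_mul_factor (edges_perm n (rcons E (o, b))) (e := (o, b)) ab.
have -> : (edges_perm n (rcons E (o, b)) * factor_perm n (o, b))%g = edges_perm n E.
  by rewrite edges_perm_rcons -mulgA /factor_perm tperm2 mulg1.
rewrite size_rcons in cardE leN.
(* If [o] and [b] were in different cycles, removing the factor would merge them and violate the
   lower bound [ltE]. *)
case: (boolP (_ \notin _)) => [_ |]; rewrite ?negbK /= => bo; first by lia.
move=> nbE.
case: ms => [|m ms] in leN ms_gt0 sum_ms permE *; first by move: sum_ms => /=; lia.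
move: ms_gt0 sum_ms leN => /= /andP[m_gt0 ms_gt0] sum_ms leN.
(* The first interval is stable under the permutation, so it contains the orbit of [o]. *)
have bm : b < o + m.
  have := @porbit_closed _ _ (fun z : 'I_n.+1 => o <= z < o + m) _ _ _ _ bo.
  rewrite !inordK; [|lia|lia]; case/(_ _ _)/andP => //; [move=> z zA|lia].
  rewrite permE /= /cycle_step; repeat case: ifP; lia.
(* Removing the factor cuts the first cycle at [b] into two consecutive intervals. *)
have [||||||| x|ts [msE ->]] // := IHN E o [:: b - o, m - (b - o) & ms]; rewrite /=.
- by lia.
- by rewrite ms_gt0 andbT; lia.
- by lia.
- by lia.
- rewrite -[edges_perm n E]mulg1 -[1%g](tperm2 (inord o) (inord b)) mulgA.
  rewrite -[tperm _ _]/(factor_perm n (o, b)) -edges_perm_rcons permM.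
  rewrite val_factor_perm //= permE /=.
  have -> : o + (b - o) = b by lia.
  have -> : b + (m - (b - o)) = o + m by lia.
  have := @intervals_step_ge (o + m) ms x.
  by rewrite /cycle_step; repeat case: ifP; lia.
case: ts msE => [|t [|u ts]] //= [tE uE <-].
(* The first two trees have roots [o] and [b]; the peeled edge grafts the second onto the first. *)
exists (graft t u :: ts); rewrite /= nb_vertices_graft preorder_edges_graft.
rewrite -!rcons_cat !addnA tE uE; split; last by rewrite catA subnKC //; lia.
by congr cons; lia.
Qed.

(** * Decreasing factorisations are the preorder edge lists of trees *)

Lemma T3_preorder_edges n (hn : 1 < n.+1) (f : n.-tuple {perm 'I_n.+1}) t :
  nb_vertices t = n.+1 ->
  f = [seq factor_perm n e | e <- preorder_edges t 0] :> seq _ ->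
  @T3 n.+1 hn f = t.
Proof.
move=> nbt fE; have sizeE := size_preorder_edges t 0.
rewrite /T3 /T1 (forget_subtree_below fE) ?preorder_edges_uniq //=.
- by rewrite -[RHS](tree_above_preorder_edges 0 (leqnn _)) nbt.
- by apply: preorder_edges_in; rewrite nbt.
(* At the root [p] is [None], so no edge may enter [0]; indeed targets exceed their sources. *)
- move=> k; symmetry; apply/eqP => k0.
  have kE : nth (0, 0) (preorder_edges t 0) k \in preorder_edges t 0.
    by rewrite mem_nth // -ltnS sizeE nbt; apply: ltn_ord.
  by move/preorder_edges_range: kE; rewrite k0; lia.
Qed.

Lemma prod_tnth_edges n (f : n.-tuple {perm 'I_n.+1}) E :
  f = [seq factor_perm n e | e <- E] :> seq _ ->
  (\prod_(k < n) tnth f k)%g = edges_perm n E.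
Proof. by move=> fE; rewrite -(big_tuple _ _ f xpredT id) fE big_map. Qed.

Lemma val_long_cycle n (x : 'I_n.+1) :
  long_cycle n.+1 x = cycle_step 0 n.+1 x :> nat.
Proof.
rewrite permE /= /cycle_step add0n ltn_ord /=; case: eqP => [->|xn].
  by rewrite modnn.
by rewrite modn_small //; have := ltn_ord x; lia.
Qed.

Lemma nb_cycles_long_cycle n : nb_cycles (long_cycle n.+1) <= 1.
Proof.
suff /subset_leq_card: porbits (long_cycle n.+1) \subset [set porbit (long_cycle n.+1) ord0].
  by rewrite cards1.
apply/fintype.subsetP => _ /imsetP[x _ ->]; rewrite inE eq_porbit_mem; apply/porbitP.
(* The label [x] is reached from [0] in exactly [x] steps. *)
exists x; apply: val_inj => /=; have := ltn_ord x.
elim: (x : nat) => [|i IHi] hi; first by rewrite expg0 perm1.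
rewrite expgSr permM val_long_cycle -IHi /cycle_step; last by lia.
by repeat case: ifP; lia.
Qed.

Lemma preorder_edges_factorisation n (f : n.-tuple {perm 'I_n.+1}) t :
  nb_vertices t = n.+1 ->
  f = [seq factor_perm n e | e <- preorder_edges t 0] :> seq _ ->
  @decreasing_factorisations n.+1 f.
Proof.
move=> nbt fE; set E := preorder_edges t 0 in fE.
have sizeE : size E = n by have := size_preorder_edges t 0; rewrite nbt => -[].
have E_in : edges_in n E by apply: preorder_edges_in; rewrite nbt.
have nthE (k : 'I_n) : (nth (0, 0) E k).1 < (nth (0, 0) E k).2 <= n.
  by apply: (allP E_in); rewrite mem_nth ?sizeE.
have tnthE (k : 'I_n) : tnth f k = factor_perm n (nth (0, 0) E k).
  by rewrite (tnth_nth 1%g) fE (nth_map (0, 0)) ?sizeE.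
split; [split|].
- move=> k; rewrite tnthE; exists (inord (nth (0, 0) E k).1).
  exists (inord (nth (0, 0) E k).2); split=> //.
  by have := nthE k; rewrite -val_eqE /= => h; rewrite !inordK; lia.
- rewrite (prod_tnth_edges fE); apply/permP => x; apply: val_inj => /=.
  by rewrite val_long_cycle edges_perm_preorder nbt.
- exists (fun k => inord (nth (0, 0) E k).1), (fun k => inord (nth (0, 0) E k).2).
  split=> [k|k l].
    rewrite tnthE; case: (nth _ E k) (nthE k) => c d /= cd.
    by rewrite !inordK; [split=> //; case/andP: cd|lia|lia].
  have fst_lt (i : 'I_n) : (nth (0, 0) E i).1 < n.+1 by have := nthE i; lia.
  rewrite !inordK ?fst_lt // leq_eqVlt => /orP[/eqP/val_inj-> //|kl].
  have /(pairwiseP (0, 0)) := preorder_edges_decreasing t 0.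
  by apply; rewrite ?inE ?sizeE.
Qed.

Lemma factorisation_preorder_edges n (f : n.-tuple {perm 'I_n.+1}) :
  @decreasing_factorisations n.+1 f ->
  exists2 t, nb_vertices t = n.+1 &
    f = [seq factor_perm n e | e <- preorder_edges t 0] :> seq _.
Proof.
case=> -[_ prodf] [a [b [abE ba]]].
pose E := [seq (val (a k), val (b k)) | k : 'I_n <- enum 'I_n].
have fE : f = [seq factor_perm n e | e <- E] :> seq _.
  rewrite -[LHS]map_tnth_enum /E -[RHS]map_comp; apply: eq_map => k /=.
  by rewrite (abE k).2 /factor_perm !inord_val.
have permE := prod_tnth_edges fE; rewrite prodf in permE.
(* The long cycle is one interval, so the forest is a single tree; one cycle and [n] factors meet
   the bound. *)
have [|||||||ts] := @decreasing_edges_forest n E 0 [:: n.+1].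
- apply/allP => _ /mapP[k _ ->] /=.
  by rewrite (abE k).1 /= -ltnS ltn_ord.
- have : pairwise ltn [seq val k | k <- enum 'I_n].
    by rewrite val_enum_ord -sorted_pairwise ?iota_ltn_sorted //; apply: ltn_trans.
  rewrite /decreasing_edges !pairwise_map; apply: sub_pairwise => k l /ltnW.
  exact: ba.
- by apply/allP.
- by [].
- by rewrite /= addn0.
- rewrite size_map size_enum_ord -permE -[n.+1]add1n leq_add2r.
  exact: nb_cycles_long_cycle.
- by move=> x; rewrite -permE val_long_cycle /= add0n ltn_ord.
case: ts => [|t [|u ts]] [] //= [nbt] EE; exists t; rewrite -?nbt //.
by rewrite fE EE.
Qed.

(** Decreasing factorisations are exactly the tuples of preorder factors of trees, and [T3] returns
    the tree, which in turn determines the tuple. *)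
Theorem proposition7 (n : nat) (hn : 1 < n) :
  set_bij (@decreasing_factorisations n) (plane_trees n) (T3 hn).
Proof.
case: n hn => // n hn; split.
- move=> f /factorisation_preorder_edges[t nbt fE].
  by rewrite (T3_preorder_edges hn nbt fE).
- move=> f g; rewrite !inE => /factorisation_preorder_edges[t nbt fE].
  move=> /factorisation_preorder_edges[u nbu gE].
  rewrite (T3_preorder_edges hn nbt fE) (T3_preorder_edges hn nbu gE) => tu.
  by apply: val_inj; rewrite /= fE gE tu.
- move=> t nbt.
  have sz : size [seq factor_perm n e | e <- preorder_edges t 0] == n.
    by rewrite size_map -eqSS size_preorder_edges nbt.
  exists (Tuple sz); first exact: (preorder_edges_factorisation nbt).
  exact: (T3_preorder_edges hn nbt).
Qed.
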